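(* Let $g:\mathbb{R}\to\mathbb{R}$ be a real-valued periodic function with Fourier series $g(x)=\sum_{n\in\mathbb{Z}} g_n e^{inx}$, and suppose there are constants $D>0$ and $r\in(0,1)$ such that $|g_n|\le D r^{|n|}$ for all $n\in\mathbb{Z}$. Let $x_0\in\mathbb{R}$ and let $x(t)$ be the solution of $\dot x=g(x)$, $x(0)=x_0$. For $N\ge 1$ let ${\bf y}_{1,N}(t)=[y_{1,N}^+(t),\,y_{1,N}^-(t)]^{\mathsf T}$ be the first block of the solution of the finite-section approximation of order $N$ of the Carleman-Fourier linearization of this system (defined in the context). Set $$T_0=\frac{1}{2D}\Big(\frac{1}{\sqrt r}-1\Big)^2,$$ and let $N_0\ge 1$ be an integer with $N_0\ge \dfrac{2\sqrt{2DT_0}}{1-r}$. For $N\ge N_0$ let $\vartheta_{1,N}^{\pm}:[0,T_0]\to\mathbb{R}$ be the continuous phase functions determined by $$y_{1,N}^{\pm}(t)=|y_{1,N}^{\pm}(t)|\,e^{i\vartheta_{1,N}^{\pm}(t)},\qquad \vartheta_{1,N}^{\pm}(0)=\pm x_0 .$$ Then for all $N\ge N_0$ and $0\le t\le T_0$, $$\big|\vartheta_{1,N}^{\pm}(t)\mp x(t)\big|\le \frac{4\sqrt{2Dt}}{N(1-r)}\Big(\big(1+\sqrt{2Dt}\big)^2 r\Big)^N .$$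
   Context: For integers $1\le k\le l$ define the $(k+1)\times(l+1)$ matrix ${\bf B}_{k,l}=[b_{k,l;p,q}]_{0\le p\le k,\,0\le q\le l}$ by $b_{k,l;p,q}=i(k-2p)\,g_{l-k}$ if $q=p$; $b_{k,l;p,q}=i(k-2p)\,g_{k-l}$ if $q=l-k+p$; and $b_{k,l;p,q}=0$ otherwise (when $l=k$ the first two cases coincide and give the diagonal entry $i(k-2p)g_0$). For $k\ge 1$ let ${\bf y}_k^0=[e^{ikx_0},e^{i(k-2)x_0},\ldots,e^{-i(k-2)x_0},e^{-ikx_0}]^{\mathsf T}\in\mathbb{C}^{k+1}$, i.e. the $p$-th entry is $e^{i(k-2p)x_0}$, $0\le p\le k$. The finite-section approximation of order $N\ge1$ of the Carleman-Fourier linearization is the finite-dimensional block upper triangular linear system for unknowns ${\bf y}_{k,N}(t)\in\mathbb{C}^{k+1}$, $1\le k\le N$: $$\dot{\bf y}_{k,N}(t)=\sum_{l=k}^{N}{\bf B}_{k,l}\,{\bf y}_{l,N}(t),\qquad {\bf y}_{k,N}(0)={\bf y}_k^0,\qquad 1\le k\le N .$$ Its first block is ${\bf y}_{1,N}(t)=[y_{1,N}^+(t),y_{1,N}^-(t)]^{\mathsf T}\in\mathbb{C}^2$. For $N\ge N_0$ the functions $y_{1,N}^{\pm}$ are continuous and nowhere zero on $[0,T_0]$, so the continuous phases $\vartheta_{1,N}^{\pm}$ are well defined. The displayed inequality is asserted for both choices of sign (upper signs together, lower signs together). *)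

(* Defs.v *)
(* Stdlib real numbers with Coquelicot. *)
From Stdlib Require Export Reals ZArith.
From Coquelicot Require Export Coquelicot.
Open Scope R_scope.

(* e^{i theta} *)
Definition expi (theta : R) : C := (cos theta, sin theta).

(* Pointwise convergence of the symmetric partial sums.  Coefficients bounded
   by a two-sided geometric sequence make the series absolutely convergent, so
   the order of summation is immaterial. *)
Definition has_fourier_series (g : R -> R) (gc : Z -> C) : Prop :=
  forall u : R,
    filterlim
      (fun M : nat =>
         sum_n (fun j : nat =>
                  let n := (Z.of_nat j - Z.of_nat M)%Z in
                  Cmult (gc n) (expi (IZR n * u))) (2 * M))
      eventually (locally (RtoC (g u))).

Definition Icc (a b : R) : R -> Prop := fun t => a <= t <= b.

(* f' = v on [0, T] for a function living on [0, T] only: the derivative is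
   required in the interior and f has to be continuous up to the endpoints.
   When v is continuous on [0, T], as in the differential equations below, the
   one-sided derivatives of f at 0 and T then exist and equal v there. *)
Definition has_derivative_on {V : NormedModule R_AbsRing}
    (T : R) (f v : R -> V) : Prop :=
  continuous_on (Icc 0 T) f /\
  forall t : R, 0 < t < T -> is_derive f t (v t).

Definition freq (k p : nat) : R := INR k - 2 * INR p.

(* Entry (p, q) of B_{k,l}; only used for 1 <= k <= l, p <= k and q <= l, so
   that the subtraction l - k on nat is exact. *)
Definition Bentry (gc : Z -> C) (k l p q : nat) : C :=
  if Nat.eqb q p then
    Cmult (Cmult Ci (RtoC (freq k p))) (gc (Z.of_nat l - Z.of_nat k)%Z)
  else if Nat.eqb q (l - k + p) then
    Cmult (Cmult Ci (RtoC (freq k p))) (gc (Z.of_nat k - Z.of_nat l)%Z)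
  else RtoC 0.

(* Y k p is the p-th entry (0 <= p <= k) of the block y_{k,N}; values of Y at
   other indices play no role. *)
Definition finite_section_solution
    (gc : Z -> C) (x0 T : R) (N : nat) (Y : nat -> nat -> R -> C) : Prop :=
  forall k p : nat, (1 <= k <= N)%nat -> (p <= k)%nat ->
    Y k p 0 = expi (freq k p * x0) /\
    has_derivative_on (V := C_R_NormedModule) T (Y k p)
      (fun t => sum_n_m (fun l : nat =>
                  sum_n (fun q : nat => Cmult (Bentry gc k l p q) (Y l q t)) l)
                k N).

Definition is_continuous_phase (T : R) (z : R -> C) (theta0 : R)
    (theta : R -> R) : Prop :=
  continuous_on (Icc 0 T) theta /\
  theta 0 = theta0 /\
  forall t : R, 0 <= t <= T ->
    z t = Cmult (RtoC (Cmod (z t))) (expi (theta t)).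

Definition T_zero (D r : R) : R := 1 / (2 * D) * (1 / sqrt r - 1) ^ 2.

Definition phase_bound (D r : R) (N : nat) (t : R) : R :=
  4 * sqrt (2 * D * t) / (INR N * (1 - r)) *
  ((1 + sqrt (2 * D * t)) ^ 2 * r) ^ N.

(* Main.v *)
Require Import Defs.
From Stdlib Require Import Lra Lia Psatz.

(** Put y_{k,p} = e^{i(k-2p)x(t)}.  Along the true solution these monomials
    satisfy y_{k,p}' = i(k-2p) g(x) y_{k,p}, and inserting the Fourier series of
    g turns the right-hand side into the infinite linear system of which the
    finite section keeps the blocks of order at most N.  The error
    E_{k,p} = Y_{k,p} - y_{k,p} thus starts at 0 and solves the truncated system
    with a source made of the discarded Fourier modes |n| > N - k.

    The coefficient g_0 is real because g is, so the diagonal term of the system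
    only rotates E_{k,p} and does not affect its modulus.  What remains couples
    block k to the blocks l > k with strength 2kD r^(l-k), and the source is at
    most 2kD r^(N-k+1)/(1-r).  After factoring r^(N-k+1)/(1-r) out of the error
    in block k and passing to the time tau = 2Dt, the majorant system has no
    parameter left:
      eps_k' = k (1 + eps_{k+1} + ... + eps_N),   eps_k(0) = 0.
    With J the integration from 0, the sums S_k = 1 + eps_k + ... + eps_N obey
    S_k = (1 + kJ) S_{k+1}, hence eps_1 = (1 + 2J) ... (1 + NJ) tau
    ([majorant], [truncation_error]).

    The operators 1 + kJ commute, so eps_1 can also be built up by increasing N,
    and its coefficients, which are elementary symmetric functions of 2, ..., N
    divided by factorials, are bounded by induction on N by those of even degree
    in s(1+s)^(2N)/(2N), where s^2 = tau ([esym_le], [majorant_bound]).  With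
    s = sqrt(2Dt) this says that the error in block 1 is at most one eighth of
    the announced bound ([majorant_le_phase_bound]).

    The choice of T_0 makes (1+s)^2 r <= 1 and the choice of N_0 makes the
    remaining factor at most 2, so the error is at most 1/4.  Therefore
    Y e^{-ix} stays in the right half plane, the phase difference starts at 0 and
    cannot leave (-pi/2, pi/2), and there it is controlled by its sine
    ([phase_error]). *)

(** * The majorant system *)

(** With J the integration from 0, this is
    (1 + kJ)(1 + (k+1)J) ... (1 + (k+n-1)J) applied to tau^j/j!.  Carrying j
    along lets J act as j |-> j + 1, so that no integral has to be taken. *)
Fixpoint majorant (k n j : nat) (tau : R) : R :=
  match n with
  | O => tau ^ j / INR (fact j)
  | S n' => majorant (S k) n' j tau + INR k * majorant (S k) n' (S j) tau
  end.

Lemma fact_S (n : nat) : INR (fact (S n)) = INR (S n) * INR (fact n).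
Proof. rewrite <- mult_INR. reflexivity. Qed.

Lemma majorant_derive (n k j : nat) (tau : R) :
  is_derive (majorant k n (S j)) tau (majorant k n j tau).
Proof.
  revert k j; induction n as [|n IH]; intros k j.
  - cbn [majorant].
    rewrite fact_S.
    pose proof (INR_fact_neq_0 j). pose proof (not_0_INR (S j) ltac:(lia)).
    set (c := INR (S j)) in *. set (f := INR (fact j)) in *.
    auto_derive; [easy|]. change (match j with 0%nat => 1 | S _ => INR j + 1 end) with c.
    field; auto.
  - cbn [majorant].
    apply (is_derive_plus (V := R_NormedModule)); [apply IH|].
    apply is_derive_scal; apply IH.
Qed.

Lemma majorant_at_0 (n k j : nat) : majorant k n (S j) 0 = 0.
Proof.
  revert k j; induction n as [|n IH]; intros k j; cbn [majorant].
  - rewrite pow_i by lia. unfold Rdiv; ring.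
  - rewrite !IH; ring.
Qed.

(** The factors 1 + iJ commute: the last one can be applied first.  The error
    estimate peels off the factor with the smallest index, the coefficient
    estimate the one with the largest. *)
Lemma majorant_succ_r (n k j : nat) (tau : R) :
  majorant k (S n) j tau =
  majorant k n j tau + INR (k + n) * majorant k n (S j) tau.
Proof.
  revert k j; induction n as [|n IH]; intros k j.
  - cbn [majorant]. rewrite Nat.add_0_r. reflexivity.
  - change (majorant k (S (S n)) j tau)
      with (majorant (S k) (S n) j tau + INR k * majorant (S k) (S n) (S j) tau).
    rewrite (IH (S k) j), (IH (S k) (S j)). cbn [majorant].
    replace (S k + n)%nat with (k + S n)%nat by lia. ring.
Qed.

(** The elementary symmetric function of degree m in 2, 3, ..., n + 1. *)
Fixpoint esym (n m : nat) : R :=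
  match n, m with
  | _, O => 1
  | O, S _ => 0
  | S n', S m' => esym n' (S m') + INR (n' + 2) * esym n' m'
  end.

Lemma esym_0_r (n : nat) : esym n 0 = 1.
Proof. destruct n; reflexivity. Qed.

Lemma esym_big (n m : nat) : (n < m)%nat -> esym n m = 0.
Proof.
  revert m; induction n as [|n IH]; intros [|m] Hm; try lia; cbn [esym].
  - reflexivity.
  - rewrite !IH by lia; ring.
Qed.

Lemma majorant_expansion (n j : nat) (tau : R) :
  majorant 2 n j tau =
  sum_f_R0 (fun m => esym n m * (tau ^ (m + j) / INR (fact (m + j)))) n.
Proof.
  revert j; induction n as [|n IH]; intros j.
  - simpl; ring.
  - rewrite majorant_succ_r, !IH, (decomp_sum _ (S n)) by lia.
    rewrite scal_sum. cbn [Nat.pred].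
    rewrite (sum_eq (fun i => esym (S n) (S i) *
              (tau ^ (S i + j) / INR (fact (S i + j))))
       (fun i => esym n (S i) * (tau ^ (S i + j) / INR (fact (S i + j))) +
         esym n i * (tau ^ (i + S j) / INR (fact (i + S j))) * INR (2 + n))).
    2:{ intros i _. cbn [esym]. replace (i + S j)%nat with (S i + j)%nat by lia.
        replace (n + 2)%nat with (2 + n)%nat by lia. ring. }
    rewrite sum_plus, <- Rplus_assoc. f_equal.
    destruct n as [|n].
    + simpl; ring.
    + rewrite (decomp_sum _ (S n)) by lia. cbn [Nat.pred].
      rewrite (tech5 (fun i => esym (S n) (S i) * _)).
      rewrite (esym_big (S n) (S (S n))) by lia.
      rewrite !esym_0_r. ring.
Qed.

(** This is C(2n+2, 2m+1) / (2n+2) for n = m + d, a binomial coefficient of odd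
    index.  Writing it in terms of m and d = n - m keeps the subtraction out of
    the induction. *)
Definition half_binom (m d : nat) : R :=
  INR (fact (2 * (m + d) + 1)) / (INR (fact (2 * m + 1)) * INR (fact (2 * d + 1))).

Lemma fact_SS (n : nat) :
  INR (fact (2 * S n + 1)) =
  (2 * INR n + 3) * (2 * INR n + 2) * INR (fact (2 * n + 1)).
Proof.
  replace (2 * S n + 1)%nat with (S (S (2 * n + 1))) by lia.
  rewrite !fact_S, !S_INR, plus_INR, mult_INR. simpl (INR 1). simpl (INR 2). ring.
Qed.

(** Both parts of the recursion for [esym] can be expressed as fractions of the
    bound.  For index (n+1, m+1) and d = n - m they add up to
    1 - 2d(m+1)(2m+5) / ((m+2)(2m+2d+3)(2m+2d+2)), which is at most 1. *)
Lemma esym_le (n m d : nat) :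
  n = (m + d)%nat -> esym n m <= INR (fact (m + 1)) * half_binom m d.
Proof.
  revert m d; induction n as [|n IH]; intros [|m] d Hn; try lia.
  - assert (d = 0)%nat by lia; subst d. unfold half_binom; simpl. lra.
  - rewrite esym_0_r. unfold half_binom. cbn [Nat.add Nat.mul].
    simpl (INR (fact 1)). pose proof (INR_fact_lt_0 (d + (d + 0) + 1)).
    right; field; lra.
  - cbn [esym].
    pose proof (IH m d ltac:(lia)) as H1.
    assert (H2 : esym n (S m) <= INR (fact (S m + 1)) * half_binom (S m) d *
       ((2 * INR d + 1) * (2 * INR d) /
         ((2 * INR (m + d) + 3) * (2 * INR (m + d) + 2)))).
    { pose proof (pos_INR (m + d)).
      (* For d = 0 there are too few variables, and the factor d of the fraction
         vanishes too. *)
      destruct d as [|d].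
      - rewrite esym_big by lia. simpl (INR 0). right. field. lra.
      - eapply Rle_trans; [apply (IH (S m) d ltac:(lia))|]. right.
        unfold half_binom.
        replace (S m + S d)%nat with (S (m + S d)) by lia.
        replace (S m + d)%nat with (m + S d)%nat by lia.
        rewrite (fact_SS (m + S d)), (fact_SS d), S_INR.
        pose proof (INR_fact_lt_0 (2 * S m + 1)).
        pose proof (INR_fact_lt_0 (2 * d + 1)). pose proof (pos_INR d).
        field. repeat split; lra. }
    assert (H3 : INR (fact (m + 1)) * half_binom m d =
       INR (fact (S m + 1)) * half_binom (S m) d *
       ((2 * INR m + 3) * (2 * INR m + 2) / (INR m + 2) /
         ((2 * INR (m + d) + 3) * (2 * INR (m + d) + 2)))).
    { unfold half_binom.
      replace (S m + d)%nat with (S (m + d)) by lia.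
      rewrite (fact_SS (m + d)), (fact_SS m).
      replace (S m + 1)%nat with (S (m + 1)) by lia.
      rewrite fact_S, S_INR, plus_INR. simpl (INR 1).
      pose proof (INR_fact_lt_0 (2 * m + 1)). pose proof (INR_fact_lt_0 (2 * d + 1)).
      pose proof (pos_INR m). pose proof (pos_INR (m + d)).
      field. repeat split; lra. }
    rewrite H3 in H1.
    set (W := INR (fact (S m + 1)) * half_binom (S m) d) in *.
    assert (HW : 0 <= W).
    { unfold W, half_binom, Rdiv. apply Rmult_le_pos; [apply pos_INR|].
      apply Rmult_le_pos; [apply pos_INR|].
      apply Rlt_le, Rinv_0_lt_compat, Rmult_lt_0_compat; apply INR_fact_lt_0. }
    assert (Hn2 : INR (n + 2) = INR m + INR d + 2).
    { replace n with (m + d)%nat by lia. rewrite !plus_INR. simpl; ring. }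
    pose proof (pos_INR m) as Hm. pose proof (pos_INR d) as Hd.
    rewrite Hn2. rewrite plus_INR in H1, H2.
    eapply Rle_trans;
      [apply Rplus_le_compat;
        [exact H2 | apply Rmult_le_compat_l; [lra | exact H1]]|].
    generalize dependent (INR m). generalize dependent (INR d). intros d' Hd m' ? ? ? ? Hm.
    clear - HW Hd Hm.
    match goal with |- ?l <= _ => replace l with (W * (1 -
       d' * (m' + 1) * (4 * m' + 10) / (m' + 2) / ((2 * (m' + d') + 3) * (2 * (m' + d') + 2)))) end.
    2:{ field. lra. }
    rewrite <- (Rmult_1_r W) at 2. apply Rmult_le_compat_l; [exact HW|].
    assert (0 <= d' * (m' + 1) * (4 * m' + 10) / (m' + 2) /
                   ((2 * (m' + d') + 3) * (2 * (m' + d') + 2))).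
    { apply Rdiv_le_0_compat; [apply Rdiv_le_0_compat|]; nra. }
    lra.
Qed.

Lemma sum_odd_le (f : nat -> R) (n : nat) :
  (forall i, 0 <= f i) ->
  sum_f_R0 (fun m => f (2 * m + 1)%nat) n <= sum_f_R0 f (2 * n + 2).
Proof.
  intros Hf. induction n as [|n IH].
  - simpl. pose proof (Hf 0%nat). pose proof (Hf 2%nat). lra.
  - replace (2 * S n + 2)%nat with (S (S (2 * n + 2))) by lia.
    rewrite !tech5. replace (2 * S n + 1)%nat with (S (2 * n + 2)) by lia.
    pose proof (Hf (S (S (2 * n + 2)))). lra.
Qed.

(** The coefficient of s^(2m+2) on the left is at most that of the term of
    index 2m + 1 in the binomial expansion of (1+s)^(2n+2), up to the common
    factor 1/(2n+2) and one power of s; the terms of even index are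
    nonnegative. *)
Lemma majorant_bound (n : nat) (s : R) :
  0 <= s ->
  majorant 2 n 1 (s ^ 2) <= s * (1 + s) ^ (2 * n + 2) / INR (2 * n + 2).
Proof.
  intros Hs. rewrite majorant_expansion.
  assert (H0 : 0 < INR (2 * n + 2)) by (apply lt_0_INR; lia).
  apply Rle_trans with
    (s / INR (2 * n + 2) *
      sum_f_R0 (fun i => Binomial.C (2 * n + 2) i * s ^ i) (2 * n + 2)).
  - assert (Hc : forall i, 0 <= Binomial.C (2 * n + 2) i * s ^ i).
    { intros i. apply Rmult_le_pos; [|apply pow_le; exact Hs].
      unfold Binomial.C. apply Rdiv_le_0_compat; [apply pos_INR|].
      apply Rmult_lt_0_compat; apply INR_fact_lt_0. }
    eapply Rle_trans; [|apply Rmult_le_compat_l; [apply Rdiv_le_0_compat; lra|]].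
    2:{ apply (sum_odd_le _ n Hc). }
    rewrite scal_sum. apply sum_Rle. intros m Hm.
    pose proof (esym_le n m (n - m) ltac:(lia)) as He.
    pose proof (INR_fact_lt_0 (m + 1)) as Hf.
    eapply Rle_trans.
    { apply Rmult_le_compat_r; [|exact He].
      apply Rdiv_le_0_compat; [apply pow_le, pow_le; lra|exact Hf]. }
    right. unfold half_binom, Binomial.C.
    replace (m + (n - m))%nat with n by lia.
    replace (2 * n + 2 - (2 * m + 1))%nat with (2 * (n - m) + 1)%nat by lia.
    replace (fact (2 * n + 2)) with (fact (S (2 * n + 1))) by (f_equal; lia).
    rewrite fact_S. replace (S (2 * n + 1)) with (2 * n + 2)%nat by lia.
    rewrite <- pow_mult. replace (2 * (m + 1))%nat with (S (2 * m + 1)) by lia.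
    rewrite <- tech_pow_Rmult.
    pose proof (INR_fact_lt_0 (2 * m + 1)). pose proof (INR_fact_lt_0 (2 * (n - m) + 1)).
    field. repeat split; lra.
  - rewrite (Rplus_comm 1 s), binomial.
    right. unfold Rdiv. rewrite Rmult_assoc, (Rmult_comm (/ _)), <- Rmult_assoc. do 2 f_equal.
    apply sum_eq. intros i _. rewrite pow1. ring.
Qed.

(** * Functions on a closed time interval *)

Definition clamp (T t : R) : R := Rmax 0 (Rmin T t).

Lemma clamp_id (T t : R) : 0 <= t <= T -> clamp T t = t.
Proof. intros Ht. unfold clamp. rewrite Rmin_right, Rmax_right; lra. Qed.

Lemma clamp_in (T t : R) : 0 <= T -> 0 <= clamp T t <= T.
Proof.
  intros HT. unfold clamp. split; [apply Rmax_l|].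
  apply Rmax_lub; [exact HT | apply Rmin_l].
Qed.

Lemma clamp_dist (T t u : R) : Rabs (clamp T u - clamp T t) <= Rabs (u - t).
Proof.
  unfold clamp, Rmax, Rmin.
  destruct (Rle_dec T u), (Rle_dec T t);
    repeat match goal with |- context [Rle_dec 0 ?b] => destruct (Rle_dec 0 b) end;
    apply Rabs_le; split; unfold Rabs; destruct (Rcase_abs (u - t)); lra.
Qed.

(** Continuity on [0, T] expressed as continuity on the whole line of the
    extension by constants, which is what the mean and intermediate value
    theorems can be applied to. *)
Definition continuous_upto {U : UniformSpace} (T : R) (f : R -> U) : Prop :=
  forall t : R, continuous (fun u => f (clamp T u)) t.

Lemma continuous_upto_of_on {U : UniformSpace} (T : R) (f : R -> U) :
  0 <= T -> continuous_on (Icc 0 T) f -> continuous_upto T f.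
Proof.
  intros HT Hf t P HP.
  destruct (Hf (clamp T t) (clamp_in T t HT) P HP) as [eps Heps].
  exists eps. intros u Hu. apply Heps; [|apply (clamp_in T u HT)].
  eapply Rle_lt_trans; [apply clamp_dist | exact Hu].
Qed.

Lemma continuous_upto_everywhere {U : UniformSpace} (T : R) (f : R -> U) :
  (forall t, continuous f t) -> continuous_upto T f.
Proof.
  intros Hf t. apply continuous_comp; [|apply Hf].
  intros P [eps Heps]. exists eps. intros u Hu. apply Heps.
  eapply Rle_lt_trans; [apply clamp_dist | exact Hu].
Qed.

Lemma le_initial_value (T : R) (f df : R -> R) :
  continuous_upto T f ->
  (forall t, 0 < t < T -> is_derive f t (df t)) ->
  (forall t, 0 < t < T -> df t <= 0) ->
  forall t, 0 <= t <= T -> f t <= f 0.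
Proof.
  intros Hc Hd Hneg t Ht.
  destruct (Req_dec t 0) as [->|Ht0]; [lra|].
  destruct (MVT_gen (fun u => f (clamp T u)) 0 t
              (fun u => if Rlt_dec 0 u then if Rlt_dec u T then df u else 0 else 0))
    as (c & _ & Hc').
  - rewrite Rmin_left, Rmax_right by lra. intros u Hu.
    destruct (Rlt_dec 0 u); [|lra]. destruct (Rlt_dec u T); [|lra].
    apply (is_derive_ext_loc f); [|apply Hd; lra].
    assert (He : 0 < Rmin u (T - u)) by (apply Rmin_glb_lt; lra).
    exists (mkposreal _ He). intros v Hv.
    change (Rabs (v - u) < Rmin u (T - u)) in Hv.
    pose proof (Rmin_l u (T - u)). pose proof (Rmin_r u (T - u)).
    apply Rabs_def2 in Hv. rewrite clamp_id; lra.
  - intros u _. apply continuity_pt_filterlim, Hc.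
  - rewrite !clamp_id in Hc' by lra.
    destruct (Rlt_dec 0 c); [destruct (Rlt_dec c T)|].
    + pose proof (Hneg c ltac:(lra)). nra.
    + lra.
    + lra.
Qed.

Lemma unit_pairing_le (p q x y : R) :
  p ^ 2 + q ^ 2 = 1 -> p * x - q * y <= Cmod (x, y).
Proof.
  intros Hpq. unfold Cmod; simpl fst; simpl snd.
  eapply Rle_trans; [apply Rle_abs|].
  rewrite <- sqrt_Rsqr_abs. apply sqrt_le_1_alt. unfold Rsqr.
  assert (x ^ 2 + y ^ 2 = (p * x - q * y) ^ 2 + (p * y + q * x) ^ 2).
  { transitivity ((p ^ 2 + q ^ 2) * (x ^ 2 + y ^ 2)); [rewrite Hpq|]; ring. }
  pose proof (pow2_ge_0 (p * y + q * x)). nra.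
Qed.

(** If |f' - iaf| <= phi' and f and phi vanish at 0, then |f| <= phi: the
    function e^{-iat} f has the same modulus as f and derivative of modulus at
    most phi', so its component in any fixed direction grows no faster than phi.
    The direction is that of the value at the time t1 under consideration. *)
Lemma modulus_growth (T a : R) (f1 f2 v1 v2 phi dphi : R -> R) :
  continuous_upto T f1 -> continuous_upto T f2 ->
  (forall t, 0 < t < T -> is_derive f1 t (v1 t)) ->
  (forall t, 0 < t < T -> is_derive f2 t (v2 t)) ->
  (forall t, is_derive phi t (dphi t)) ->
  f1 0 = 0 -> f2 0 = 0 -> phi 0 = 0 ->
  (forall t, 0 < t < T -> Cmod (v1 t + a * f2 t, v2 t - a * f1 t) <= dphi t) ->
  forall t, 0 <= t <= T -> Cmod (f1 t, f2 t) <= phi t.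
Proof.
  intros Hc1 Hc2 Hd1 Hd2 Hphi H1 H2 H3 Hv t1 Ht1.
  assert (Hpq : exists p q, p ^ 2 + q ^ 2 = 1 /\
                  p * f1 t1 - q * f2 t1 = Cmod (f1 t1, f2 t1)).
  { set (m := Cmod (f1 t1, f2 t1)).
    assert (Hm : m ^ 2 = f1 t1 ^ 2 + f2 t1 ^ 2).
    { unfold m, Cmod. rewrite pow2_sqrt; [reflexivity|]. simpl fst; simpl snd.
      pose proof (pow2_ge_0 (f1 t1)). pose proof (pow2_ge_0 (f2 t1)). lra. }
    destruct (Req_dec m 0) as [Hm0|Hm0].
    - exists 1, 0. split; [ring|]. rewrite Hm0 in *.
      pose proof (pow2_ge_0 (f1 t1)). pose proof (pow2_ge_0 (f2 t1)).
      assert (f1 t1 ^ 2 = 0) by lra. nra.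
    - exists (f1 t1 / m), (- (f2 t1 / m)). split.
      + transitivity ((f1 t1 ^ 2 + f2 t1 ^ 2) / m ^ 2); [field; auto|].
        rewrite <- Hm. field; auto.
      + transitivity ((f1 t1 ^ 2 + f2 t1 ^ 2) / m); [field; auto|].
        rewrite <- Hm. field; auto. }
  destruct Hpq as (p & q & Hpq & Hnorm).
  (* P + iQ = (p + iq) e^{ia(t1-t)} is the rotating direction that pairs with f to |f| at t1. *)
  set (P := fun t => p * cos (a * (t1 - t)) - q * sin (a * (t1 - t))).
  set (Q := fun t => q * cos (a * (t1 - t)) + p * sin (a * (t1 - t))).
  assert (HPQ : forall t, P t ^ 2 + Q t ^ 2 = 1).
  { intros t. unfold P, Q. pose proof (sin2_cos2 (a * (t1 - t))) as Hsc.
    unfold Rsqr in Hsc. set (S := sin _) in *. set (C' := cos _) in *.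
    transitivity ((p ^ 2 + q ^ 2) * (S * S + C' * C')); [ring|rewrite Hpq, Hsc; ring]. }
  assert (HP : forall t, is_derive P t (a * Q t)).
  { intros t. unfold P, Q. auto_derive; [easy|cbv beta; unfold Rminus; ring]. }
  assert (HQ : forall t, is_derive Q t (- a * P t)).
  { intros t. unfold P, Q. auto_derive; [easy|cbv beta; unfold Rminus; ring]. }
  pose proof (le_initial_value T (fun t => P t * f1 t - Q t * f2 t - phi t)
    (fun t => P t * (v1 t + a * f2 t) - Q t * (v2 t - a * f1 t) - dphi t)) as Hmono.
  assert (Hfin : P t1 * f1 t1 - Q t1 * f2 t1 - phi t1 <=
                 P 0 * f1 0 - Q 0 * f2 0 - phi 0).
  { apply Hmono; [| | |exact Ht1].
    - assert (HcP : continuous_upto T P).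
      { apply continuous_upto_everywhere. intros t.
        apply (ex_derive_continuous (V := R_NormedModule)). eexists; apply HP. }
      assert (HcQ : continuous_upto T Q).
      { apply continuous_upto_everywhere. intros t.
        apply (ex_derive_continuous (V := R_NormedModule)). eexists; apply HQ. }
      assert (Hcphi : continuous_upto T phi).
      { apply continuous_upto_everywhere. intros t.
        apply (ex_derive_continuous (V := R_NormedModule)). eexists; apply Hphi. }
      intros t.
      apply (continuous_minus (V := R_NormedModule)); [|apply Hcphi].
      apply (continuous_minus (V := R_NormedModule)).
      + apply (continuous_mult (K := R_AbsRing)); [apply HcP | apply Hc1].
      + apply (continuous_mult (K := R_AbsRing)); [apply HcQ | apply Hc2].
    - intros t Ht.
      replace (P t * (v1 t + a * f2 t) - Q t * (v2 t - a * f1 t) - dphi t) with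
        ((a * Q t * f1 t + P t * v1 t) - (- a * P t * f2 t + Q t * v2 t) - dphi t)
        by ring.
      apply (is_derive_minus (V := R_NormedModule)); [|apply Hphi].
      apply (is_derive_minus (V := R_NormedModule)).
      + apply (is_derive_mult P f1 t (a * Q t) (v1 t)); auto. intros; apply Rmult_comm.
      + apply (is_derive_mult Q f2 t (- a * P t) (v2 t)); auto. intros; apply Rmult_comm.
    - intros t Ht. pose proof (Hv t Ht).
      pose proof (unit_pairing_le (P t) (Q t) (v1 t + a * f2 t) (v2 t - a * f1 t) (HPQ t)).
      lra. }
  rewrite H1, H2, H3 in Hfin.
  assert (HPt : P t1 = p) by (unfold P; rewrite Rminus_diag, Rmult_0_r, cos_0, sin_0; ring).
  assert (HQt : Q t1 = q) by (unfold Q; rewrite Rminus_diag, Rmult_0_r, cos_0, sin_0; ring).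
  rewrite HPt, HQt, Hnorm in Hfin. lra.
Qed.

Lemma fst_derive (f : R -> C) (t : R) (v : C) :
  is_derive (V := C_R_NormedModule) f t v ->
  is_derive (V := R_NormedModule) (fun s => fst (f s)) t (fst v).
Proof.
  intros H.
  apply (filterdiff_comp (U := R_NormedModule) (V := C_R_NormedModule) (W := R_NormedModule)
    f (fun z : C => fst z) (fun y => scal y v) (fun z : C => fst z) H).
  apply (filterdiff_linear (K := R_AbsRing) (U := C_R_NormedModule) (V := R_NormedModule)).
  apply (is_linear_fst (K := R_AbsRing) (U := R_NormedModule) (V := R_NormedModule)).
Qed.

Lemma snd_derive (f : R -> C) (t : R) (v : C) :
  is_derive (V := C_R_NormedModule) f t v ->
  is_derive (V := R_NormedModule) (fun s => snd (f s)) t (snd v).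
Proof.
  intros H.
  apply (filterdiff_comp (U := R_NormedModule) (V := C_R_NormedModule) (W := R_NormedModule)
    f (fun z : C => snd z) (fun y => scal y v) (fun z : C => snd z) H).
  apply (filterdiff_linear (K := R_AbsRing) (U := C_R_NormedModule) (V := R_NormedModule)).
  apply (is_linear_snd (K := R_AbsRing) (U := R_NormedModule) (V := R_NormedModule)).
Qed.

Lemma fst_continuous_upto (T : R) (f : R -> C) :
  continuous_upto (U := C_R_NormedModule) T f -> continuous_upto T (fun s => fst (f s)).
Proof.
  intros Hf t. apply (continuous_comp (fun s => f (clamp T s)) fst); [apply Hf|].
  apply continuous_fst.
Qed.

Lemma snd_continuous_upto (T : R) (f : R -> C) :
  continuous_upto (U := C_R_NormedModule) T f -> continuous_upto T (fun s => snd (f s)).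
Proof.
  intros Hf t. apply (continuous_comp (fun s => f (clamp T s)) snd); [apply Hf|].
  apply continuous_snd.
Qed.

(** * Truncated Fourier sums *)

Lemma expi_add (a b : R) : expi (a + b) = Cmult (expi a) (expi b).
Proof.
  unfold expi, Cmult; simpl. rewrite cos_plus, sin_plus. f_equal; ring.
Qed.

Lemma Cmod_expi (a : R) : Cmod (expi a) = 1.
Proof.
  unfold expi, Cmod; simpl fst; simpl snd.
  rewrite <- sqrt_1. f_equal. pose proof (sin2_cos2 a) as H. unfold Rsqr in H. lra.
Qed.

(** The sum of g_n zp_n over 0 <= n <= M and of g_{-n} zm_n over 1 <= n <= M.
    With zp_n = z^n and zm_n = z^{-n} this is a partial Fourier sum; with the
    entries of the unknown blocks it is a row of the truncated system. *)
Fixpoint laurent (gc : Z -> C) (zp zm : nat -> C) (M : nat) : C :=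
  match M with
  | O => Cmult (gc 0%Z) (zp O)
  | S M' => Cplus (laurent gc zp zm M')
      (Cplus (Cmult (gc (Z.of_nat M)) (zp M)) (Cmult (gc (- Z.of_nat M)%Z) (zm M)))
  end.

Lemma laurent_minus (gc : Z -> C) (zp zm wp wm : nat -> C) (M : nat) :
  laurent gc (fun n => Cminus (zp n) (wp n)) (fun n => Cminus (zm n) (wm n)) M =
  Cminus (laurent gc zp zm M) (laurent gc wp wm M).
Proof.
  induction M as [|M IH]; cbn [laurent]; [|rewrite IH]; ring.
Qed.

Lemma laurent_scal (gc : Z -> C) (zp zm : nat -> C) (c : C) (M : nat) :
  laurent gc (fun n => Cmult c (zp n)) (fun n => Cmult c (zm n)) M =
  Cmult c (laurent gc zp zm M).
Proof.
  induction M as [|M IH]; cbn [laurent]; [|rewrite IH]; ring.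
Qed.

(** The weights enter through the increments of an arbitrary sequence s, so
    that the sum telescopes.  The geometric tail of the Fourier series and the
    row sums of the majorant system are both of this form. *)
Lemma laurent_increment (gc : Z -> C) (D r c : R) (zp zm : nat -> C) (s : nat -> R)
    (M K : nat) :
  0 < D ->
  0 <= r ->
  (forall n : Z, Cmod (gc n) <= D * r ^ Z.abs_nat n) ->
  (forall n, (M < n <= M + K)%nat -> r ^ n * Cmod (zp n) <= c * (s n - s (S n))) ->
  (forall n, (M < n <= M + K)%nat -> r ^ n * Cmod (zm n) <= c * (s n - s (S n))) ->
  Cmod (Cminus (laurent gc zp zm (M + K)) (laurent gc zp zm M)) <=
  2 * D * c * (s (S M) - s (S (M + K))).
Proof.
  intros HD Hr Hg. induction K as [|K IH]; intros Hp Hm.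
  - rewrite Nat.add_0_r. unfold Cminus. rewrite Cplus_opp_r, Cmod_0. lra.
  - rewrite Nat.add_succ_r. cbn [laurent]. rewrite <- Nat.add_succ_r.
    set (n := (M + S K)%nat).
    pose proof (IH ltac:(intros i Hi; apply Hp; lia) ltac:(intros i Hi; apply Hm; lia)) as H0.
    replace (S (M + K)) with n in H0 by (unfold n; lia).
    assert (Hn : forall (k : Z) (z : C), Z.abs_nat k = n ->
               r ^ n * Cmod z <= c * (s n - s (S n)) ->
               Cmod (Cmult (gc k) z) <= D * (c * (s n - s (S n)))).
    { intros k z Hk Hz. rewrite Cmod_mult. pose proof (Hg k) as Hgk. rewrite Hk in Hgk.
      pose proof (Cmod_ge_0 z). pose proof (Cmod_ge_0 (gc k)). nra. }
    pose proof (Hn (Z.of_nat n) (zp n) ltac:(lia) (Hp n ltac:(unfold n; lia))) as H1.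
    pose proof (Hn (- Z.of_nat n)%Z (zm n) ltac:(lia) (Hm n ltac:(unfold n; lia))) as H2.
    match goal with |- Cmod ?z <= _ => replace z with
      (Cplus (Cminus (laurent gc zp zm (M + K)) (laurent gc zp zm M))
         (Cplus (Cmult (gc (Z.of_nat n)) (zp n)) (Cmult (gc (- Z.of_nat n)%Z) (zm n))))
      by ring end.
    eapply Rle_trans; [apply Cmod_triangle|].
    pose proof (Cmod_triangle (Cmult (gc (Z.of_nat n)) (zp n))
                  (Cmult (gc (- Z.of_nat n)%Z) (zm n))).
    nra.
Qed.

Definition fourier_sum (gc : Z -> C) (u : R) (M : nat) : C :=
  laurent gc (fun n => expi (INR n * u)) (fun n => expi (- INR n * u)) M.

Lemma sum_n_head (G : AbelianMonoid) (f : nat -> G) (n : nat) :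
  sum_n f (S n) = plus (f O) (sum_n (fun i => f (S i)) n).
Proof.
  unfold sum_n. rewrite sum_Sn_m by lia. f_equal. symmetry; apply sum_n_m_S.
Qed.

(** Each step from M to M + 1 adds one mode at either end of the range. *)
Lemma symmetric_sum_eq (gc : Z -> C) (u : R) (M : nat) :
  sum_n (fun j : nat => let n := (Z.of_nat j - Z.of_nat M)%Z in
           Cmult (gc n) (expi (IZR n * u))) (2 * M) = fourier_sum gc u M.
Proof.
  induction M as [|M IH].
  - change (2 * 0)%nat with O. rewrite sum_O. reflexivity.
  - replace (2 * S M)%nat with (S (S (2 * M))) by lia.
    rewrite sum_n_head, sum_Sn.
    rewrite (sum_n_ext _ (fun j : nat => let n := (Z.of_nat j - Z.of_nat M)%Z in
           Cmult (gc n) (expi (IZR n * u)))).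
    2:{ intros j. replace (Z.of_nat (S j) - Z.of_nat (S M))%Z
          with (Z.of_nat j - Z.of_nat M)%Z by lia. reflexivity. }
    rewrite IH. unfold fourier_sum; cbn [laurent]. cbv zeta.
    replace (Z.of_nat 0 - Z.of_nat (S M))%Z with (- Z.of_nat (S M))%Z by lia.
    replace (Z.of_nat (S (S (2 * M))) - Z.of_nat (S M))%Z with (Z.of_nat (S M)) by lia.
    rewrite opp_IZR, <- INR_IZR_INZ.
    change (@plus C_AbelianMonoid) with Cplus.
    match goal with |- ?l = ?r => change (@eq C l r) end. ring.
Qed.

Lemma fourier_tail (g : R -> R) (gc : Z -> C) (D r : R) (u : R) (M : nat) :
  has_fourier_series g gc -> 0 < D -> 0 < r < 1 ->
  (forall n : Z, Cmod (gc n) <= D * r ^ Z.abs_nat n) ->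
  Cmod (Cminus (RtoC (g u)) (fourier_sum gc u M)) <= 2 * D * (r ^ S M / (1 - r)).
Proof.
  intros Hser HD Hr Hg. apply le_epsilon. intros eps Heps.
  assert (He2 : 0 < eps / 2) by lra.
  pose proof (proj1 (filterlim_locally _ _) (Hser u) (mkposreal _ He2)) as [M0 HM0].
  specialize (HM0 (M + M0)%nat ltac:(lia)). rewrite symmetric_sum_eq in HM0.
  destruct HM0 as [Hre Him].
  change (Rabs (fst (fourier_sum gc u (M + M0)) - g u) < eps / 2) in Hre.
  change (Rabs (snd (fourier_sum gc u (M + M0)) - 0) < eps / 2) in Him.
  assert (Hinc : Cmod (Cminus (fourier_sum gc u (M + M0)) (fourier_sum gc u M)) <=
     2 * D * 1 * (r ^ S M / (1 - r) - r ^ S (M + M0) / (1 - r))).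
  { apply (laurent_increment gc D r 1 _ _ (fun n => r ^ n / (1 - r))); try lra; auto.
    - intros n _. rewrite Cmod_expi, <- tech_pow_Rmult. right; field; lra.
    - intros n _. rewrite Cmod_expi, <- tech_pow_Rmult. right; field; lra. }
  assert (0 <= r ^ S (M + M0) / (1 - r)).
  { apply Rdiv_le_0_compat; [apply pow_le|]; lra. }
  assert (Hlast : Cmod (Cminus (RtoC (g u)) (fourier_sum gc u (M + M0))) <= eps).
  { eapply Rle_trans; [apply Cmod_2Rmax|].
    assert (Hs : sqrt 2 <= 2) by (rewrite <- (sqrt_pow2 2) at 2 by lra; apply sqrt_le_1_alt; lra).
    assert (Hm : Rmax (Rabs (fst (Cminus (RtoC (g u)) (fourier_sum gc u (M + M0)))))
        (Rabs (snd (Cminus (RtoC (g u)) (fourier_sum gc u (M + M0))))) <= eps / 2).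
    { apply Rmax_lub.
      - change (Rabs (g u + - fst (fourier_sum gc u (M + M0))) <= eps / 2).
        rewrite Rabs_minus_sym in Hre. unfold Rminus in Hre. lra.
      - change (Rabs (0 + - snd (fourier_sum gc u (M + M0))) <= eps / 2).
        rewrite Rabs_minus_sym in Him. unfold Rminus in Him. lra. }
    pose proof (sqrt_pos 2).
    assert (0 <= Rmax (Rabs (fst (Cminus (RtoC (g u)) (fourier_sum gc u (M + M0)))))
        (Rabs (snd (Cminus (RtoC (g u)) (fourier_sum gc u (M + M0)))))).
    { eapply Rle_trans; [apply Rabs_pos|apply Rmax_l]. }
    nra. }
  replace (Cminus (RtoC (g u)) (fourier_sum gc u M)) with
    (Cplus (Cminus (RtoC (g u)) (fourier_sum gc u (M + M0)))
       (Cminus (fourier_sum gc u (M + M0)) (fourier_sum gc u M))) by ring.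
  eapply Rle_trans; [apply Cmod_triangle|]. nra.
Qed.

(** The modes n <> 0 have 2 pi-periodic primitives. *)
Lemma im_fourier_sum_primitive (gc : Z -> C) (M : nat) :
  exists H : R -> R, H (2 * PI) = H 0 /\
    forall u, is_derive H u (snd (fourier_sum gc u M) - snd (gc 0%Z)).
Proof.
  induction M as [|M [H [Hper Hd]]].
  - exists (fun _ => 0). split; [reflexivity|]. intros u.
    unfold fourier_sum; simpl. rewrite Rmult_0_l, cos_0, sin_0.
    replace (_ - _) with 0 by ring. apply (is_derive_const (V := R_NormedModule)).
  - set (m := INR (S M)). assert (Hm : m <> 0) by (apply not_0_INR; lia).
    set (a := gc (Z.of_nat (S M))). set (b := gc (- Z.of_nat (S M))%Z).
    exists (fun u => H u + ((snd a + snd b) * sin (m * u) - (fst a - fst b) * cos (m * u)) / m).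
    assert (Hc : cos (m * (2 * PI)) = 1).
    { replace (m * (2 * PI)) with (0 + 2 * INR (S M) * PI) by (unfold m; ring).
      rewrite cos_period; apply cos_0. }
    assert (Hs : sin (m * (2 * PI)) = 0).
    { replace (m * (2 * PI)) with (0 + 2 * INR (S M) * PI) by (unfold m; ring).
      rewrite sin_period; apply sin_0. }
    split.
    + rewrite Hper, Hc, Hs, (Rmult_0_r m), cos_0, sin_0. reflexivity.
    + intros u.
      evar_last.
      * apply (is_derive_plus (V := R_NormedModule)); [apply Hd|].
        instantiate (1 := (snd a + snd b) * cos (m * u) + (fst a - fst b) * sin (m * u)).
        auto_derive; [easy|]. field; exact Hm.
      * unfold fourier_sum; cbn [laurent]. fold (fourier_sum gc u M). fold m a b.
        unfold plus; simpl. 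
        replace (- m * u) with (- (m * u)) by ring. rewrite cos_neg, sin_neg. ring.
Qed.

(** Integrating the imaginary part of a partial sum over a period leaves
    2 pi Im g_0, while g real makes that imaginary part as small as the tail of
    the series.  The integral is replaced by the mean value theorem for a
    primitive. *)
Lemma mean_coefficient_real (g : R -> R) (gc : Z -> C) (D r : R) :
  has_fourier_series g gc -> 0 < D -> 0 < r < 1 ->
  (forall n : Z, Cmod (gc n) <= D * r ^ Z.abs_nat n) ->
  snd (gc 0%Z) = 0.
Proof.
  intros Hser HD Hr Hg.
  assert (Hb : forall M, Rabs (snd (gc 0%Z)) <= 2 * D * (r ^ S M / (1 - r))).
  { intros M. destruct (im_fourier_sum_primitive gc M) as [H [Hper Hd]].
    destruct (MVT_gen H 0 (2 * PI) _ (fun u _ => Hd u)) as (c & _ & Hc).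
    { intros u _. apply continuity_pt_filterlim.
      apply (ex_derive_continuous (V := R_NormedModule)). eexists; apply Hd. }
    pose proof PI_RGT_0.
    assert (Heq : snd (gc 0%Z) = snd (fourier_sum gc c M)) by (rewrite Hper in Hc; nra).
    eapply Rle_trans; [|apply (fourier_tail g gc D r c M Hser HD Hr Hg)].
    eapply Rle_trans; [|apply Rmax_Cmod].
    eapply Rle_trans; [|apply Rmax_r].
    rewrite Heq. simpl. rewrite Rplus_0_l, Rabs_Ropp. lra. }
  destruct (Req_dec (snd (gc 0%Z)) 0) as [?|Hne]; [assumption|exfalso].
  apply Rabs_pos_lt in Hne.
  assert (Hy : 0 < Rabs (snd (gc 0%Z)) * (1 - r) / (2 * D)).
  { apply Rdiv_lt_0_compat; nra. }
  destruct (pow_lt_1_zero r ltac:(rewrite Rabs_pos_eq; lra) _ Hy) as [M HM].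
  specialize (HM (S M) ltac:(lia)). specialize (Hb M).
  rewrite Rabs_pos_eq in HM by (apply pow_le; lra).
  apply (Rmult_lt_compat_l (2 * D / (1 - r))) in HM; [|apply Rdiv_lt_0_compat; lra].
  replace (2 * D / (1 - r) * (Rabs (snd (gc 0%Z)) * (1 - r) / (2 * D))) with
    (Rabs (snd (gc 0%Z))) in HM by (field; lra).
  replace (2 * D / (1 - r) * r ^ S M) with (2 * D * (r ^ S M / (1 - r))) in HM by (field; lra).
  lra.
Qed.

(** * Rows of the linearized system *)

(** The matrix rows are sums in the abelian monoid underlying C; their
    equations have to be read in C for [ring] to apply. *)
Ltac C_ring :=
  change (@plus C_AbelianMonoid) with Cplus;
  match goal with |- ?l = ?r => change (@eq C l r) end; ring.

Lemma sum_n_single (f : nat -> C) (p l : nat) :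
  (p <= l)%nat -> (forall q, q <> p -> f q = RtoC 0) ->
  sum_n (G := C_AbelianMonoid) f l = f p.
Proof.
  intros Hp Hf. induction l as [|l IH].
  - replace p with O by lia. apply sum_O.
  - rewrite sum_Sn. change (@plus C_AbelianMonoid) with Cplus.
    destruct (Nat.eq_dec p (S l)) as [->|Hne].
    + rewrite (sum_n_ext_loc _ (fun _ => zero)).
      2:{ intros q Hq. apply Hf; lia. }
      unfold sum_n. rewrite sum_n_m_const_zero. apply Cplus_0_l.
    + rewrite IH by lia. rewrite (Hf (S l)) by lia. apply Cplus_0_r.
Qed.

Lemma diagonal_block_row (gc : Z -> C) (z : nat -> C) (k p : nat) :
  (p <= k)%nat ->
  sum_n (G := C_AbelianMonoid) (fun q => Cmult (Bentry gc k k p q) (z q)) k =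
  Cmult (Cmult Ci (RtoC (freq k p))) (Cmult (gc 0%Z) (z p)).
Proof.
  intros Hp. rewrite (sum_n_single _ p k Hp).
  - unfold Bentry. rewrite Nat.eqb_refl, Z.sub_diag. C_ring.
  - intros q Hq. unfold Bentry. rewrite Nat.sub_diag, Nat.add_0_l.
    rewrite (proj2 (Nat.eqb_neq q p) Hq). C_ring.
Qed.

(** Off the diagonal the two nonzero entries of a row lie in different columns,
    so the row splits into two one-entry rows. *)
Lemma upper_block_row (gc : Z -> C) (z : nat -> C) (k n p : nat) :
  (p <= k)%nat -> (1 <= n)%nat ->
  sum_n (G := C_AbelianMonoid)
    (fun q => Cmult (Bentry gc k (k + n) p q) (z q)) (k + n) =
  Cmult (Cmult Ci (RtoC (freq k p)))
    (Cplus (Cmult (gc (Z.of_nat n)) (z p))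
       (Cmult (gc (- Z.of_nat n)%Z) (z (n + p)%nat))).
Proof.
  intros Hp Hn.
  set (w := Cmult Ci (RtoC (freq k p))).
  set (f := fun q => if Nat.eqb q p then Cmult (Cmult w (gc (Z.of_nat n))) (z q)
                     else RtoC 0).
  set (h := fun q => if Nat.eqb q (n + p) then Cmult (Cmult w (gc (- Z.of_nat n)%Z)) (z q)
                     else RtoC 0).
  rewrite (sum_n_ext _ (fun q => plus (f q) (h q))).
  2:{ intros q. change (@plus C_AbelianMonoid) with Cplus. unfold f, h, Bentry. fold w.
      replace (k + n - k + p)%nat with (n + p)%nat by lia.
      replace (Z.of_nat (k + n) - Z.of_nat k)%Z with (Z.of_nat n) by lia.
      replace (Z.of_nat k - Z.of_nat (k + n))%Z with (- Z.of_nat n)%Z by lia.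
      destruct (Nat.eqb_spec q p), (Nat.eqb_spec q (n + p)); try lia; C_ring. }
  rewrite sum_n_plus, (sum_n_single f p), (sum_n_single h (n + p)); try lia.
  - unfold f, h. rewrite !Nat.eqb_refl. C_ring.
  - intros q Hq. unfold h. rewrite (proj2 (Nat.eqb_neq _ _) Hq). reflexivity.
  - intros q Hq. unfold f. rewrite (proj2 (Nat.eqb_neq _ _) Hq). reflexivity.
Qed.

Lemma truncated_row (gc : Z -> C) (z : nat -> nat -> C) (k p M : nat) :
  (p <= k)%nat ->
  sum_n_m (G := C_AbelianMonoid) (fun l : nat =>
    sum_n (G := C_AbelianMonoid) (fun q : nat => Cmult (Bentry gc k l p q) (z l q)) l)
    k (k + M) =
  Cmult (Cmult Ci (RtoC (freq k p)))
    (laurent gc (fun n => z (k + n)%nat p) (fun n => z (k + n)%nat (n + p)%nat) M).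
Proof.
  intros Hp. induction M as [|M IH].
  - cbn [laurent]. rewrite !Nat.add_0_r, sum_n_n. apply diagonal_block_row, Hp.
  - rewrite Nat.add_succ_r, sum_n_Sm by lia. rewrite IH. cbn [laurent].
    rewrite <- Nat.add_succ_r, upper_block_row by lia.
    C_ring.
Qed.

Lemma freq_abs_le (k p : nat) : (p <= k)%nat -> Rabs (freq k p) <= INR k.
Proof.
  intros Hp. unfold freq. apply le_INR in Hp. pose proof (pos_INR p).
  apply Rabs_le. lra.
Qed.

(** * The truncation error *)

(** Downward induction on k, that is, strong induction on M = N - k: the blocks
    l > k enter the equation of block k through [laurent_increment] with
    s_n = S_{k+n}, whose increments are eps_{k+n}; the discarded modes contribute
    the missing 1 = s_{M+1}; and [modulus_growth] integrates the sum, which is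
    2Dk s_1 = 2Dk S_{k+1} times r^(M+1)/(1-r).  In terms of [majorant],
    S_k = majorant k (N-k+1) 0 and eps_k = k majorant (k+1) (N-k) 1. *)
Lemma truncation_error (g : R -> R) (gc : Z -> C) (D r x0 T : R) (x : R -> R)
    (N : nat) (Y : nat -> nat -> R -> C) :
  has_fourier_series g gc -> 0 < D -> 0 < r < 1 ->
  (forall n : Z, Cmod (gc n) <= D * r ^ Z.abs_nat n) ->
  0 <= T -> x 0 = x0 ->
  has_derivative_on (V := R_NormedModule) T x (fun t => g (x t)) ->
  finite_section_solution gc x0 T N Y ->
  forall M k p : nat, (1 <= k)%nat -> (k + M = N)%nat -> (p <= k)%nat ->
  forall t, 0 <= t <= T ->
    Cmod (Cminus (Y k p t) (expi (freq k p * x t))) <=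
    r ^ S M / (1 - r) * (INR k * majorant (S k) M 1 (2 * D * t)).
Proof.
  intros Hser HD Hr Hg HT Hx0 [Hxc Hxd] HY M.
  induction M as [M IH] using lt_wf_ind. intros k p Hk HkM Hp.
  destruct (HY k p ltac:(lia) Hp) as [Hinit [Hcont Hder]].
  apply continuous_upto_of_on in Hcont; [|exact HT].
  assert (Hxcu : continuous_upto (U := R_UniformSpace) T x)
    by (apply continuous_upto_of_on; assumption).
  set (w := freq k p) in *. set (c := r ^ S M / (1 - r)).
  set (V := fun t => Cmult (Cmult Ci (RtoC w))
    (laurent gc (fun n => Y (k + n)%nat p t) (fun n => Y (k + n)%nat (n + p)%nat t) M)).
  assert (HV : forall t, 0 < t < T -> is_derive (V := C_R_NormedModule) (Y k p) t (V t)).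
  { intros t Ht. unfold V, w. rewrite <- (truncated_row gc (fun l q => Y l q t) k p M Hp).
    rewrite HkM. exact (Hder t Ht). }
  intros t Ht.
  change (Cmod (fst (Y k p t) - cos (w * x t), snd (Y k p t) - sin (w * x t)) <=
    c * (INR k * majorant (S k) M 1 (2 * D * t))).
  apply (modulus_growth T (w * fst (gc 0%Z))
    (fun t => fst (Y k p t) - cos (w * x t))
    (fun t => snd (Y k p t) - sin (w * x t))
    (fun t => fst (V t) - - w * g (x t) * sin (w * x t))
    (fun t => snd (V t) - w * g (x t) * cos (w * x t))
    (fun t => c * (INR k * majorant (S k) M 1 (2 * D * t)))
    (fun t => c * (INR k * (2 * D * majorant (S k) M 0 (2 * D * t)))) ); [..|exact Ht].
  - intros u. apply (continuous_minus (V := R_NormedModule)).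
    + apply (fst_continuous_upto T (Y k p) Hcont).
    + apply (continuous_comp (fun s => w * x (clamp T s)) cos).
      * apply (continuous_scal_r (V := R_NormedModule)), Hxcu.
      * apply continuity_pt_filterlim, continuity_cos.
  - intros u. apply (continuous_minus (V := R_NormedModule)).
    + apply (snd_continuous_upto T (Y k p) Hcont).
    + apply (continuous_comp (fun s => w * x (clamp T s)) sin).
      * apply (continuous_scal_r (V := R_NormedModule)), Hxcu.
      * apply continuity_pt_filterlim, continuity_sin.
  - intros u Hu. apply (is_derive_minus (V := R_NormedModule)).
    + apply fst_derive, HV, Hu.
    + evar_last.
      * apply (is_derive_comp (V := R_NormedModule) cos (fun s => w * x s)).
        -- apply is_derive_Reals, derivable_pt_lim_cos.
        -- apply is_derive_scal, (Hxd u Hu).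
      * unfold scal; simpl; unfold mult; simpl; ring.
  - intros u Hu. apply (is_derive_minus (V := R_NormedModule)).
    + apply snd_derive, HV, Hu.
    + evar_last.
      * apply (is_derive_comp (V := R_NormedModule) sin (fun s => w * x s)).
        -- apply is_derive_Reals, derivable_pt_lim_sin.
        -- apply is_derive_scal, (Hxd u Hu).
      * unfold scal; simpl; unfold mult; simpl; ring.
  - intros u. apply is_derive_scal, is_derive_scal. evar_last.
    + apply (is_derive_comp (V := R_NormedModule) (majorant (S k) M 1) (fun s => 2 * D * s)).
      * apply majorant_derive.
      * apply is_derive_scal, (is_derive_id (K := R_AbsRing)).
    + unfold scal, one; simpl; unfold mult; simpl; ring.
  - rewrite Hinit, Hx0. unfold expi; simpl. ring.
  - rewrite Hinit, Hx0. unfold expi; simpl. ring.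
  - rewrite Rmult_0_r, majorant_at_0. ring.
  - clear t Ht. intros t Ht.
    set (y := expi (w * x t)).
    set (zp := fun n => Cminus (Y (k + n)%nat p t) (Cmult y (expi (INR n * x t)))).
    set (zm := fun n => Cminus (Y (k + n)%nat (n + p)%nat t) (Cmult y (expi (- INR n * x t)))).
    assert (Hzp : forall n, (n <= M)%nat ->
       zp n = Cminus (Y (k + n)%nat p t) (expi (freq (k + n) p * x t))).
    { intros n _. unfold zp, y, w. rewrite <- expi_add. do 2 f_equal.
      unfold freq. rewrite plus_INR. ring. }
    assert (Hzm : forall n, (n <= M)%nat ->
       zm n = Cminus (Y (k + n)%nat (n + p)%nat t) (expi (freq (k + n) (n + p) * x t))).
    { intros n _. unfold zm, y, w. rewrite <- expi_add. do 2 f_equal.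
      unfold freq. rewrite !plus_INR. ring. }
    pose (s := fun n => majorant (k + n) (S M - n) 0 (2 * D * t)).
    assert (Hstep : forall n q, (0 < n <= M)%nat -> (q <= k + n)%nat ->
      r ^ n * Cmod (Cminus (Y (k + n)%nat q t) (expi (freq (k + n) q * x t))) <=
        c * (s n - s (S n))).
    { intros n q Hn Hq.
      pose proof (IH (M - n)%nat ltac:(lia) (k + n)%nat q ltac:(lia) ltac:(lia) Hq t
        ltac:(lra)) as H.
      apply Rmult_le_compat_l with (r := r ^ n) in H; [|apply pow_le; lra].
      eapply Rle_trans; [exact H|]. right. unfold s, c.
      replace (S M - n)%nat with (S (M - n)) by lia.
      replace (k + S n)%nat with (S (k + n)) by lia.
      replace (S M - S n)%nat with (M - n)%nat by lia. cbn [majorant].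
      replace (S M) with (n + S (M - n))%nat by lia. rewrite pow_add. field. lra. }
    pose proof (laurent_increment gc D r c zp zm s 0 M HD ltac:(lra) Hg) as Hinc.
    cbn [Nat.add] in Hinc.
    specialize (Hinc ltac:(intros n Hn; rewrite Hzp by lia; apply Hstep; lia)
                     ltac:(intros n Hn; rewrite Hzm by lia; apply Hstep; lia)).
    assert (Hs1 : s 1%nat = majorant (S k) M 0 (2 * D * t)).
    { unfold s. f_equal; lia. }
    assert (HsM : s (S M) = 1).
    { unfold s. rewrite Nat.sub_diag. simpl. field. }
    rewrite Hs1, HsM in Hinc.
    pose proof (fourier_tail g gc D r (x t) M Hser HD Hr Hg) as Htail. fold c in Htail.
    assert (Hg0 : gc 0%Z = RtoC (fst (gc 0%Z))).
    { rewrite (surjective_pairing (gc 0%Z)) at 1.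
      rewrite (mean_coefficient_real g gc D r Hser HD Hr Hg). reflexivity. }
    assert (Hlin : laurent gc zp zm M = Cminus
       (laurent gc (fun n => Y (k + n)%nat p t) (fun n => Y (k + n)%nat (n + p)%nat t) M)
       (Cmult y (fourier_sum gc (x t) M))).
    { unfold zp, zm. rewrite laurent_minus, laurent_scal. reflexivity. }
    assert (Hz0 : zp 0%nat = Cminus (Y k p t) y).
    { rewrite Hzp by lia. rewrite Nat.add_0_r. reflexivity. }
    (* E' - i w g_0 E = i w (coupling to higher blocks - y times the Fourier tail). *)
    match goal with |- Cmod ?z <= _ => replace z with
      (Cmult (Cmult Ci (RtoC w))
         (Cminus (Cminus (laurent gc zp zm M) (laurent gc zp zm 0))
            (Cmult y (Cminus (RtoC (g (x t))) (fourier_sum gc (x t) M))))) end.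
    2:{ transitivity (Cminus (V t) (Cmult (Cmult Ci (RtoC w))
          (Cplus (Cmult (RtoC (g (x t))) y)
             (Cmult (RtoC (fst (gc 0%Z))) (Cminus (Y k p t) y))))).
        - rewrite Hlin. cbn [laurent]. rewrite Hz0, <- Hg0. unfold V. ring.
        - unfold y, expi. destruct (V t) as [V1 V2]. destruct (Y k p t) as [Y1 Y2].
          unfold Cminus, Cplus, Cmult, Copp, Ci, RtoC; simpl. f_equal; ring. }
    rewrite !Cmod_mult, Cmod_Ci, Cmod_R, Rmult_1_l.
    pose proof (freq_abs_le k p Hp) as Hw. fold w in Hw.
    assert (Hsum : Cmod (Cminus (Cminus (laurent gc zp zm M) (laurent gc zp zm 0))
            (Cmult y (Cminus (RtoC (g (x t))) (fourier_sum gc (x t) M)))) <=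
            c * (2 * D * majorant (S k) M 0 (2 * D * t))).
    { unfold Cminus at 1. eapply Rle_trans; [apply Cmod_triangle|].
      rewrite Cmod_opp, Cmod_mult. unfold y. rewrite Cmod_expi. lra. }
    rewrite <- Rmult_assoc, (Rmult_comm c), Rmult_assoc.
    apply Rmult_le_compat; [apply Rabs_pos | apply Cmod_ge_0 | exact Hw | exact Hsum].
Qed.

(** * From distance to phase *)

Lemma abs_le_3_abs_sin (u : R) : Rabs u <= PI / 2 -> Rabs u <= 3 * Rabs (sin u).
Proof.
  assert (Hpos : forall v, 0 <= v <= PI / 2 -> v <= 3 * sin v).
  { intros v Hv. pose proof PI_4. pose proof PI_RGT_0.
    destruct (SIN v ltac:(lra) ltac:(lra)) as [Hlb _].
    (* The Taylor polynomial v - v^3/6 + v^5/120 - v^7/5040 is at least v/3 on [0, 2]. *)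
    unfold sin_lb, sin_approx, sin_term in Hlb. simpl in Hlb.
    assert (0 <= v <= 2) by lra.
    assert (v * v <= 4) by nra.
    assert (0 <= v * (v * v)) by (apply Rmult_le_pos; nra).
    assert (0 <= v * (v * v) * (v * v)) by (apply Rmult_le_pos; nra).
    assert (v * (v * v) <= 4 * v) by nra.
    assert (v * (v * v) * (v * v) * (v * v) <= 4 * (v * (v * v) * (v * v))) by nra.
    nra. }
  intros Hu. destruct (Rle_dec 0 u) as [H|H].
  - rewrite Rabs_pos_eq in * by lra. pose proof (Hpos u ltac:(lra)).
    pose proof (Rle_abs (sin u)). lra.
  - rewrite Rabs_left in * by lra. pose proof (Hpos (- u) ltac:(lra)) as H1.
    rewrite sin_neg in H1. pose proof (Rle_abs (- sin u)). rewrite Rabs_Ropp in *. lra.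
Qed.

(** Multiplication by e^{-i xi} preserves the distance and moves the reference
    point to 1. *)
Lemma unit_comparison (m theta xi delta : R) :
  Cmod (Cminus (Cmult (RtoC m) (expi theta)) (expi xi)) <= delta ->
  1 - delta <= m * cos (theta - xi) /\ Rabs (m * sin (theta - xi)) <= delta.
Proof.
  intros H.
  replace (Cminus (Cmult (RtoC m) (expi theta)) (expi xi)) with
    (Cmult (expi xi) (Cminus (Cmult (RtoC m) (expi (theta - xi))) (RtoC 1))) in H.
  2:{ replace theta with (xi + (theta - xi)) at 2 by ring. rewrite expi_add. ring. }
  rewrite Cmod_mult, Cmod_expi, Rmult_1_l in H.
  pose proof (Rmax_Cmod (Cminus (Cmult (RtoC m) (expi (theta - xi))) (RtoC 1))) as Hmax.
  assert (Hm : Rmax (Rabs (m * cos (theta - xi) - 1)) (Rabs (m * sin (theta - xi))) <= delta).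
  { eapply Rle_trans; [|exact H]. eapply Rle_trans; [|exact Hmax]. right.
    unfold Cminus, Cplus, Copp, Cmult, RtoC, expi; simpl. f_equal; f_equal; ring. }
  pose proof (Rmax_l (Rabs (m * cos (theta - xi) - 1)) (Rabs (m * sin (theta - xi)))).
  pose proof (Rmax_r (Rabs (m * cos (theta - xi) - 1)) (Rabs (m * sin (theta - xi)))).
  split; [|lra].
  assert (Ha : Rabs (m * cos (theta - xi) - 1) <= delta) by lra.
  apply Rabs_le_between in Ha. lra.
Qed.

(** Closeness to e^{i xi} keeps cos (theta - xi) positive, so by the intermediate
    value theorem theta - xi, which starts at 0, never reaches pi/2 or -pi/2.
    In that range |theta - xi| <= 3 |sin (theta - xi)|, and the sine is at most
    delta / |z| <= 2 delta. *)
Lemma phase_error (T : R) (z : R -> C) (xi theta delta : R -> R) :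
  0 <= T ->
  continuous_on (Icc 0 T) xi ->
  is_continuous_phase T z (xi 0) theta ->
  (forall t, 0 <= t <= T -> Cmod (Cminus (z t) (expi (xi t))) <= delta t) ->
  (forall t, 0 <= t <= T -> delta t <= 1 / 2) ->
  forall t, 0 <= t <= T -> Rabs (theta t - xi t) <= 8 * delta t.
Proof.
  intros HT Hxi [Hth [Hth0 Hz]] Hd Hsmall.
  apply continuous_upto_of_on in Hxi; [|exact HT].
  apply continuous_upto_of_on in Hth; [|exact HT].
  assert (Hcmp : forall t, 0 <= t <= T ->
     1 - delta t <= Cmod (z t) * cos (theta t - xi t) /\
     Rabs (Cmod (z t) * sin (theta t - xi t)) <= delta t).
  { intros t Ht. apply unit_comparison. rewrite <- (Hz t Ht). apply Hd, Ht. }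
  assert (Hcos : forall t, 0 <= t <= T -> 0 < cos (theta t - xi t)).
  { intros t Ht. destruct (Hcmp t Ht) as [H _]. pose proof (Hsmall t Ht).
    pose proof (Cmod_ge_0 (z t)). nra. }
  assert (Hcont : continuity (fun t => theta (clamp T t) - xi (clamp T t))).
  { intros t. apply continuity_pt_filterlim.
    apply (continuous_minus (V := R_NormedModule) (fun s => theta (clamp T s))
      (fun s => xi (clamp T s))); [apply Hth | apply Hxi]. }
  assert (Hno : forall t y, 0 <= t <= T -> cos y = 0 ->
     ~ (Rmin 0 (theta t - xi t) <= y <= Rmax 0 (theta t - xi t))).
  { intros t y Ht Hy Hb.
    destruct (IVT_gen (fun t => theta (clamp T t) - xi (clamp T t)) 0 t y Hcont)
      as (u & Hu & Huy).
    - rewrite !clamp_id by lra. rewrite Hth0, Rminus_diag. exact Hb.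
    - rewrite Rmin_left, Rmax_right in Hu by lra.
      rewrite clamp_id in Huy by lra.
      pose proof (Hcos u ltac:(lra)) as Hc. rewrite Huy, Hy in Hc. lra. }
  intros t Ht.
  assert (Hhalf : Rabs (theta t - xi t) <= PI / 2).
  { pose proof PI_RGT_0.
    pose proof (Hno t (PI / 2) Ht cos_PI2) as H1.
    pose proof (Hno t (- (PI / 2)) Ht ltac:(rewrite cos_neg; apply cos_PI2)) as H2.
    apply Rnot_lt_le. intros H3. destruct (Rle_dec 0 (theta t - xi t)).
    - rewrite Rabs_pos_eq in H3 by lra. apply H1.
      rewrite Rmin_left, Rmax_right by lra. lra.
    - rewrite Rabs_left in H3 by lra. apply H2.
      rewrite Rmin_right, Rmax_left by lra. lra. }
  pose proof (abs_le_3_abs_sin _ Hhalf) as H3.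
  destruct (Hcmp t Ht) as [H1 H2]. pose proof (Hsmall t Ht).
  pose proof (COS_bound (theta t - xi t)) as [_ Hc1].
  pose proof (Cmod_ge_0 (z t)) as Hm0.
  assert (Hm : 1 / 2 <= Cmod (z t)) by nra.
  rewrite Rabs_mult, (Rabs_pos_eq _ Hm0) in H2.
  pose proof (Rabs_pos (sin (theta t - xi t))). nra.
Qed.

(** * The bound and the theorem *)

Lemma T_zero_nonneg (D r : R) : 0 < D -> 0 <= T_zero D r.
Proof.
  intros HD. unfold T_zero. apply Rmult_le_pos; [|apply pow2_ge_0].
  apply Rdiv_le_0_compat; lra.
Qed.

Lemma sqrt_T_zero (D r : R) : 0 < D -> 0 < r < 1 ->
  sqrt (2 * D * T_zero D r) = 1 / sqrt r - 1.
Proof.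
  intros HD Hr.
  assert (Hs : 0 < sqrt r) by (apply sqrt_lt_R0; lra).
  assert (Hs1 : sqrt r <= 1) by (rewrite <- sqrt_1; apply sqrt_le_1_alt; lra).
  replace (2 * D * T_zero D r) with ((1 / sqrt r - 1) ^ 2)
    by (unfold T_zero; field; lra).
  apply sqrt_pow2.
  apply (Rmult_le_reg_l (sqrt r)); [exact Hs|].
  replace (sqrt r * (1 / sqrt r - 1)) with (1 - sqrt r) by (field; lra). lra.
Qed.

(** At t = T_0 one has s = 1/sqrt r - 1, hence (1+s)^2 r = 1, and N >= N_0 says
    that s / (N(1-r)) <= 1/2; both quantities increase with t. *)
Lemma phase_bound_le (D r : R) (N0 N : nat) (t : R) :
  0 < D -> 0 < r < 1 -> (1 <= N0 <= N)%nat ->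
  INR N0 >= 2 * sqrt (2 * D * T_zero D r) / (1 - r) ->
  0 <= t <= T_zero D r ->
  phase_bound D r N t <= 2.
Proof.
  intros HD Hr HN HN0 Ht. unfold phase_bound.
  pose proof (sqrt_T_zero D r HD Hr) as Hs0.
  assert (Hs : sqrt (2 * D * t) <= sqrt (2 * D * T_zero D r)).
  { apply sqrt_le_1_alt. nra. }
  pose proof (sqrt_pos (2 * D * t)) as Hpos.
  set (s := sqrt (2 * D * t)) in *. set (s0 := sqrt (2 * D * T_zero D r)) in *.
  assert (Hq : 0 < sqrt r) by (apply sqrt_lt_R0; lra).
  assert (Hone : (1 + s) ^ 2 * r <= 1).
  { apply (Rle_trans _ ((1 + s0) ^ 2 * r)).
    - apply Rmult_le_compat_r; [lra|]. apply pow_incr; lra.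
    - right. rewrite Hs0. rewrite <- (pow2_sqrt r) at 2 by lra. field. lra. }
  assert (Hpow : ((1 + s) ^ 2 * r) ^ N <= 1).
  { rewrite <- (pow1 N) at 2. apply pow_incr. split; [|exact Hone].
    apply Rmult_le_pos; [apply pow2_ge_0 | lra]. }
  assert (Hpow0 : 0 <= ((1 + s) ^ 2 * r) ^ N).
  { apply pow_le, Rmult_le_pos; [apply pow2_ge_0 | lra]. }
  assert (HNN : INR N0 <= INR N) by (apply le_INR; lia).
  assert (HNpos : 0 < INR N) by (apply lt_0_INR; lia).
  assert (HNs : 2 * s <= INR N * (1 - r)).
  { apply (Rle_trans _ (2 * s0)); [lra|].
    replace (2 * s0) with (2 * s0 / (1 - r) * (1 - r)) by (field; lra). nra. }
  assert (Hfac : 4 * s / (INR N * (1 - r)) <= 2).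
  { apply Rdiv_le_1 in HNs; [|nra].
    replace (4 * s / (INR N * (1 - r))) with (2 * (2 * s / (INR N * (1 - r))))
      by (field; split; lra). lra. }
  assert (Hfac0 : 0 <= 4 * s / (INR N * (1 - r))).
  { apply Rdiv_le_0_compat; nra. }
  nra.
Qed.

Lemma majorant_le_phase_bound (D r : R) (n : nat) (t : R) :
  0 < D -> 0 < r < 1 -> 0 <= t ->
  r ^ S n / (1 - r) * (INR 1 * majorant 2 n 1 (2 * D * t)) <=
  phase_bound D r (S n) t / 8.
Proof.
  intros HD Hr Ht. unfold phase_bound.
  pose proof (sqrt_pos (2 * D * t)) as Hpos.
  assert (Hs2 : sqrt (2 * D * t) ^ 2 = 2 * D * t) by (apply pow2_sqrt; nra).
  set (s := sqrt (2 * D * t)) in *. rewrite <- Hs2.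
  pose proof (majorant_bound n s Hpos) as Hb.
  assert (HN : 0 < INR (S n)) by (apply lt_0_INR; lia).
  eapply Rle_trans.
  { apply Rmult_le_compat_l; [apply Rdiv_le_0_compat; [apply pow_le|]; lra|].
    apply Rmult_le_compat_l; [apply pos_INR | exact Hb]. }
  right. replace (2 * n + 2)%nat with (2 * S n)%nat by lia.
  rewrite Rpow_mult_distr, <- pow_mult, mult_INR.
  change (INR 1) with 1. change (INR 2) with 2. field. lra.
Qed.

Theorem corollary3p2 :
  forall (g : R -> R) (gc : Z -> C) (D r x0 : R) (x : R -> R) (N0 : nat),
    (forall u : R, g (u + 2 * PI) = g u) ->
    has_fourier_series g gc ->
    0 < D ->
    0 < r < 1 ->
    (forall n : Z, Cmod (gc n) <= D * r ^ Z.abs_nat n) ->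
    x 0 = x0 ->
    has_derivative_on (V := R_NormedModule) (T_zero D r) x (fun t => g (x t)) ->
    (1 <= N0)%nat ->
    INR N0 >= 2 * sqrt (2 * D * T_zero D r) / (1 - r) ->
    forall (N : nat) (Y : nat -> nat -> R -> C),
      (N0 <= N)%nat ->
      finite_section_solution gc x0 (T_zero D r) N Y ->
      (forall t : R, 0 <= t <= T_zero D r ->
         Y 1%nat 0%nat t <> RtoC 0 /\ Y 1%nat 1%nat t <> RtoC 0) /\
      (forall theta_plus : R -> R,
         is_continuous_phase (T_zero D r) (Y 1%nat 0%nat) x0 theta_plus ->
         forall t : R, 0 <= t <= T_zero D r ->
           Rabs (theta_plus t - x t) <= phase_bound D r N t) /\
      (forall theta_minus : R -> R,
         is_continuous_phase (T_zero D r) (Y 1%nat 1%nat) (- x0) theta_minus ->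
         forall t : R, 0 <= t <= T_zero D r ->
           Rabs (theta_minus t + x t) <= phase_bound D r N t).
Proof.
  intros g gc D r x0 x N0 _ Hser HD Hr Hg Hx0 Hx HN0 HN0r N Y HN HY.
  pose proof (T_zero_nonneg D r HD) as HT.
  assert (Hsmall : forall t, 0 <= t <= T_zero D r -> phase_bound D r N t / 8 <= 1 / 2).
  { intros t Ht.
    pose proof (phase_bound_le D r N0 N t HD Hr ltac:(lia) HN0r Ht). lra. }
  assert (Herr : forall p t, (p <= 1)%nat -> 0 <= t <= T_zero D r ->
    Cmod (Cminus (Y 1%nat p t) (expi (freq 1 p * x t))) <= phase_bound D r N t / 8).
  { intros p t Hp Ht. destruct N as [|n]; [lia|].
    eapply Rle_trans; [|apply majorant_le_phase_bound; lra].
    apply (truncation_error g gc D r x0 (T_zero D r) x (S n) Y); auto. }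
  assert (Hplus : forall t, 0 <= t <= T_zero D r ->
    Cmod (Cminus (Y 1%nat 0%nat t) (expi (x t))) <= phase_bound D r N t / 8).
  { intros t Ht. replace (x t) with (freq 1 0 * x t) by (unfold freq; simpl; ring).
    apply Herr; [lia | exact Ht]. }
  assert (Hminus : forall t, 0 <= t <= T_zero D r ->
    Cmod (Cminus (Y 1%nat 1%nat t) (expi (- x t))) <= phase_bound D r N t / 8).
  { intros t Ht. replace (- x t) with (freq 1 1 * x t) by (unfold freq; simpl; ring).
    apply Herr; [lia | exact Ht]. }
  destruct Hx as [Hxc _].
  split; [|split].
  - assert (Hne : forall (z : C) (a b : R), Cmod (Cminus z (expi a)) <= b -> b <= 1 / 2 ->
                    z <> RtoC 0).
    { intros z a b H1 H2 ->. unfold Cminus in H1.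
      rewrite Cplus_0_l, Cmod_opp, Cmod_expi in H1. lra. }
    intros t Ht. split.
    + exact (Hne _ _ _ (Hplus t Ht) (Hsmall t Ht)).
    + exact (Hne _ _ _ (Hminus t Ht) (Hsmall t Ht)).
  - intros theta Hth t Ht. rewrite <- Hx0 in Hth.
    pose proof (phase_error _ _ x theta (fun t => phase_bound D r N t / 8)
      HT Hxc Hth Hplus Hsmall t Ht) as H.
    cbv beta in H. lra.
  - intros theta Hth t Ht. rewrite <- Hx0 in Hth.
    assert (Hxn : continuous_on (Icc 0 (T_zero D r)) (fun t => - x t)).
    { intros u Hu. apply (filterlim_comp _ _ _ x Ropp _ (locally (x u))); [apply Hxc, Hu|].
      apply (filterlim_opp (V := R_NormedModule)). }
    pose proof (phase_error _ _ (fun t => - x t) theta (fun t => phase_bound D r N t / 8)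
      HT Hxn Hth Hminus Hsmall t Ht) as H.
    cbv beta in H. unfold Rminus in H. rewrite Ropp_involutive in H. lra.
Qed.
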